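(* The following eight mesh patterns $(12,R)$ are pairwise equidistributed, where $R$ ranges over: $\{(1,2),(2,2)\}$, $\{(2,2),(2,1)\}$, $\{(0,1),(0,0)\}$, $\{(0,0),(1,0)\}$, $\{(1,2),(1,1)\}$, $\{(0,1),(1,1)\}$, $\{(1,1),(2,1)\}$, $\{(1,1),(1,0)\}$. Moreover, for each such pattern $p$, the numbers $s_{n,k}(p)$ satisfy $$s_{n,k}(p)=s_{n-1,k}(p)+(n-1)\,s_{n-1,k-1}(p)$$ (with $s_{m,-1}(p)=0$) with initial conditions $s_{0,0}(p)=s_{1,0}(p)=1$ and $s_{1,1}(p)=0$; consequently $s_{n,k}(p)=c(n,n-k)$, where $c(n,j)$ is the unsigned Stirling number of the first kind (the number of permutations of $[n]$ with exactly $j$ cycles). The bivariate exponential generating function is $$\sum_{n\ge0}\sum_{k\ge0}s_{n,k}(p)\frac{x^n}{n!}q^k=(1-xq)^{-1/q}.$$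
   Context: For $R\subseteq\{0,1,2\}^2$ and $\pi=\pi_1\cdots\pi_n\in S_n$, an occurrence of the mesh pattern $(12,R)$ in $\pi$ is a pair of positions $i_1<i_2$ with $\pi_{i_1}<\pi_{i_2}$ such that, setting $x_0=0,x_1=i_1,x_2=i_2,x_3=n+1$ and $y_0=0,y_1=\pi_{i_1},y_2=\pi_{i_2},y_3=n+1$, for every $(a,b)\in R$ there is no index $k$ with $x_a<k<x_{a+1}$ and $y_b<\pi_k<y_{b+1}$. $s_{n,k}(p)$ is the number of $\pi\in S_n$ with exactly $k$ occurrences of $p$; $p_1,p_2$ are equidistributed if $s_{n,k}(p_1)=s_{n,k}(p_2)$ for all $n,k\ge 0$. *)

(* Defs.v *)
From HB Require Import structures.
From mathcomp Require Import all_boot all_order all_algebra all_fingroup.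

Set Implicit Arguments.
Unset Strict Implicit.
Unset Printing Implicit Defensive.

Import GRing.Theory.
Local Open Scope ring_scope.

(** ** Mesh patterns (12, R) *)

(* The shading R; the underlying classical pattern is always 12. *)
Definition mesh12 := {set 'I_3 * 'I_3}.

(* The x_a (resp. y_b) of an occurrence, where u, v : 'I_n stand for the
   1-based positions (resp. values) u.+1 and v.+1. *)
Definition gridline (n : nat) (u v : 'I_n) (a : nat) : nat :=
  nth 0%N [:: 0; u.+1; v.+1; n.+1]%N a.

Definition in_cell (n : nat) (pi : 'S_n) (i1 i2 : 'I_n) (c : 'I_3 * 'I_3)
    (k : 'I_n) : bool :=
  (gridline i1 i2 c.1 < k.+1 < gridline i1 i2 c.1.+1)%N &&
  (gridline (pi i1) (pi i2) c.2 < (pi k).+1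
     < gridline (pi i1) (pi i2) c.2.+1)%N.

Definition is_occurrence (n : nat) (R : mesh12) (pi : 'S_n) (i1 i2 : 'I_n)
    : bool :=
  [&& (i1 < i2)%N, (pi i1 < pi i2)%N &
      [forall c in R, ~~ [exists k, in_cell pi i1 i2 c k]]].

Definition occurrences (n : nat) (R : mesh12) (pi : 'S_n) : nat :=
  #|[set ij : 'I_n * 'I_n | is_occurrence R pi ij.1 ij.2]|.

Definition s (R : mesh12) (n k : nat) : nat :=
  #|[set pi : 'S_n | occurrences R pi == k]|.

Definition equidistributed (R1 R2 : mesh12) : Prop :=
  forall n k : nat, s R1 n k = s R2 n k.

Definition cell (a b : nat) (ha : (a < 3)%N) (hb : (b < 3)%N) : 'I_3 * 'I_3 :=
  (Ordinal ha, Ordinal hb).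
Notation "⟦ a , b ⟧" := (@cell a%N b%N isT isT) (at level 0, a, b at level 99).

Definition eight_patterns : seq mesh12 :=
  [:: [set ⟦1, 2⟧; ⟦2, 2⟧];
      [set ⟦2, 2⟧; ⟦2, 1⟧];
      [set ⟦0, 1⟧; ⟦0, 0⟧];
      [set ⟦0, 0⟧; ⟦1, 0⟧];
      [set ⟦1, 2⟧; ⟦1, 1⟧];
      [set ⟦0, 1⟧; ⟦1, 1⟧];
      [set ⟦1, 1⟧; ⟦2, 1⟧];
      [set ⟦1, 1⟧; ⟦1, 0⟧]].

(** ** Unsigned Stirling numbers of the first kind *)

Definition stirling1 (n j : nat) : nat :=
  #|[set sigma : 'S_n | #|porbits sigma| == j]|.

(** ** Formal power series *)

(* f : fps K stands for the sum of the f n * x^n. *)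
Definition fps (K : Type) := nat -> K.

Definition fps_one (K : fieldType) : fps K := fun n => (n == 0%N)%:R.

Definition fps_X (K : fieldType) : fps K := fun n => (n == 1%N)%:R.

Definition fps_sub (K : fieldType) (f g : fps K) : fps K := fun n => f n - g n.

Definition fps_scale (K : fieldType) (a : K) (f : fps K) : fps K :=
  fun n => a * f n.

Definition fps_mul (K : fieldType) (f g : fps K) : fps K :=
  fun n => \sum_(i < n.+1) f i * g (n - i)%N.

Definition fps_expn (K : fieldType) (f : fps K) (m : nat) : fps K :=
  iter m (fps_mul f) (fps_one K).

Definition gbinomial (K : fieldType) (a : K) (m : nat) : K :=
  (\prod_(i < m) (a - i%:R)) / m`!%:R.

(* f ^ a = \sum_m gbinomial a m * (f - 1)^m, for K of characteristic 0 and
   f 0 = 1. Then (f - 1)^m has order at least m, so the terms with m > n do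
   not contribute to the coefficient of x^n. *)
Definition fps_pow (K : fieldType) (f : fps K) (a : K) : fps K :=
  fun n => \sum_(m < n.+1)
    gbinomial a m * fps_expn (fps_sub f (fps_one K)) m n.

(* The field Q(q) of rational functions, and its generator. *)
Definition Qq : fieldType := {fraction {poly rat}}.

Definition q : Qq := tofrac ('X : {poly rat}).

Lemma occurrences_le (n : nat) (R : mesh12) (pi : 'S_n) :
  (occurrences R pi <= n * n)%N.
Proof.
by rewrite (leq_trans (max_card _)) // card_prod card_ord.
Qed.

Lemma s_eq0 (R : mesh12) (n k : nat) : (n * n < k)%N -> s R n k = 0%N.
Proof.
move=> lt_k; apply: eq_card0 => pi; rewrite inE.
by apply/eqP => def_k; have := occurrences_le R pi; rewrite def_k leqNgt lt_k.
Qed.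

(* The coefficient of x^n, namely the sum over all k of
   s R n k / n! * q^k; the truncation loses nothing, as coef_egf_poly shows. *)
Definition egf_poly (R : mesh12) (n : nat) : {poly rat} :=
  \poly_(k < (n * n).+1) ((s R n k)%:R / n`!%:R).

Lemma coef_egf_poly (R : mesh12) (n k : nat) :
  (egf_poly R n)`_k = (s R n k)%:R / n`!%:R.
Proof.
rewrite coef_poly ltnS; case: leqP => // /s_eq0 ->.
by rewrite mul0r.
Qed.

Definition egf (R : mesh12) : fps Qq := fun n => tofrac (egf_poly R n).

(* Main.v *)
(** For each of the eight shadings, either every entry i that is not a
    right-to-left maximum is the lower point of exactly one occurrence, whose
    upper point is extremal (nearest, farthest, smallest or largest) among the
    entries to the right of and above i, or, symmetrically, every entry that is
    not a left-to-right minimum is the upper point of exactly one occurrence.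
    So occurrences count non-records. Inserting a new first (resp. last) entry
    adds one non-record except for exactly one of its n + 1 possible values,
    and inserting a new element into the cycles of a permutation raises n minus
    the number of cycles in the same way; hence the common recurrence. It says
    that the row generating polynomials are the products of the 1 + i q for
    i < n, and these are n! times the coefficients of the binomial series. *)

Require Import Defs.
From HB Require Import structures.
From mathcomp Require Import all_boot all_order all_algebra all_fingroup.
From mathcomp Require Import zify ring.

Set Implicit Arguments.
Unset Strict Implicit.
Unset Printing Implicit Defensive.

Import GRing.Theory.
Local Open Scope ring_scope.

(** * Occurrences as non-records *)

(** Since [key] is injective, each [i] with some [r]-partner has exactly one partner of maximal key,
    so the first projection is a bijection from the pairs in [o]. *)
Lemma card_extremal_pairs (T : finType) (r o : rel T) (key : T -> nat) :
  injective key ->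
  (forall i j, o i j = r i j && [forall k, r i k ==> (key k <= key j)%N]) ->
  #|[set ij : T * T | o ij.1 ij.2]| = #|[set i | [exists j, r i j]]|.
Proof.
move=> key_inj oE.
rewrite -(card_in_imset (f := fst)) => [|[i j] [i' j'] /=].
  apply: eq_card => i; rewrite inE; apply/imsetP/existsP.
    by case=> -[i' j]; rewrite inE /= oE => /andP[rij _] ->; exists j.
  case=> j0 rij0; case: (arg_maxnP key rij0) => j rij jmax.
  exists (i, j) => //; rewrite inE /= oE rij /=.
  by apply/forallP => k; apply/implyP => /jmax.
rewrite !inE /= !oE => /andP[rij /forallP maxj] /andP[rij' /forallP maxj'] eqi.
subst i'; congr (_, _); apply/key_inj/eqP; rewrite eqn_leq.
by rewrite (implyP (maxj' _) rij) (implyP (maxj _) rij').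
Qed.

Definition num_nonrlmax (n : nat) (pi : 'S_n) : nat :=
  #|[set i : 'I_n | [exists j : 'I_n, (i < j)%N && (pi i < pi j)%N]]|.

Definition num_nonlrmin (n : nat) (pi : 'S_n) : nat :=
  #|[set j : 'I_n | [exists i : 'I_n, (i < j)%N && (pi i < pi j)%N]]|.

Lemma is_occurrence_set2 (n : nat) (c1 c2 : 'I_3 * 'I_3) (pi : 'S_n)
    (i j : 'I_n) :
  is_occurrence [set c1; c2] pi i j =
  ((i < j)%N && (pi i < pi j)%N) &&
  [forall k, ~~ in_cell pi i j c1 k && ~~ in_cell pi i j c2 k].
Proof.
rewrite /is_occurrence -andbA; congr [&& _, _ & _].
apply/forallP/forallP => [H k | H c].
  have := H c1; have := H c2; rewrite !inE !eqxx orbT /=.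
  by rewrite !negb_exists => /forallP-> /forallP->.
apply/implyP; rewrite !inE negb_exists => /orP[]/eqP->;
  by apply/forallP => k; have /andP[] := H k.
Qed.

Lemma occurrences_nonrlmax (n : nat) (pi : 'S_n) (c1 c2 : 'I_3 * 'I_3)
    (key : 'I_n -> 'I_n) :
  injective key ->
  (forall i j k : 'I_n, (i < j)%N -> (pi i < pi j)%N ->
     ~~ in_cell pi i j c1 k && ~~ in_cell pi i j c2 k =
     ((i < k)%N && (pi i < pi k)%N ==> (key k <= key j)%N)) ->
  occurrences [set c1; c2] pi = num_nonrlmax pi.
Proof.
move=> key_inj cellE; apply: (@card_extremal_pairs _ _ _ (val \o key)).
  exact: inj_comp val_inj key_inj.
move=> i j; rewrite is_occurrence_set2.
case: (boolP ((i < j)%N && (pi i < pi j)%N)) => //= /andP[lt_ij lt_pij].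
by apply: eq_forallb => k; apply: cellE.
Qed.

(** Swapping the coordinates puts the upper point first, so that the lower point becomes the partner
    selected by [key]. *)
Lemma occurrences_nonlrmin (n : nat) (pi : 'S_n) (c1 c2 : 'I_3 * 'I_3)
    (key : 'I_n -> 'I_n) :
  injective key ->
  (forall i j k : 'I_n, (i < j)%N -> (pi i < pi j)%N ->
     ~~ in_cell pi i j c1 k && ~~ in_cell pi i j c2 k =
     ((k < j)%N && (pi k < pi j)%N ==> (key k <= key i)%N)) ->
  occurrences [set c1; c2] pi = num_nonlrmin pi.
Proof.
move=> key_inj cellE.
pose swap (ij : 'I_n * 'I_n) := (ij.2, ij.1).
have swapK : cancel swap swap by case.
rewrite /occurrences -(card_preimset _ (can_inj swapK)).
have -> : swap @^-1: [set ij | is_occurrence [set c1; c2] pi ij.1 ij.2] =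
          [set ji | is_occurrence [set c1; c2] pi ji.2 ji.1].
  by apply/setP => ij; rewrite !inE.
apply: (@card_extremal_pairs 'I_n (fun j i => (i < j)%N && (pi i < pi j)%N)
  (fun j i => is_occurrence [set c1; c2] pi i j) (val \o key)).
  exact: inj_comp val_inj key_inj.
move=> j i; rewrite is_occurrence_set2.
case: (boolP ((i < j)%N && (pi i < pi j)%N)) => //= /andP[lt_ij lt_pij].
by apply: eq_forallb => k; apply: cellE.
Qed.

(** The key is the position or the value of the selected point, reversed by [rev_ord] when the
    extremum is a minimum. *)
Lemma eight_patternsP (R : mesh12) : R \in eight_patterns ->
  (forall n (pi : 'S_n), occurrences R pi = num_nonrlmax pi) \/
  (forall n (pi : 'S_n), occurrences R pi = num_nonlrmin pi).
Proof.
(* Cells are open, so [lia] must treat points on grid lines separately; this tells it that sharing a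
   row means sharing a column. *)
have perm_val n (pi : 'S_n) (k j : 'I_n) :
    (pi k == pi j :> nat) = (k == j :> nat).
  exact: (inj_eq (@perm_inj _ pi)).
have perm_rev_inj n (pi : 'S_n) : injective (fun k => rev_ord (pi k)).
  by move=> k j /rev_ord_inj/perm_inj.
rewrite !inE.
case/or4P => [/eqP->|/eqP->|/eqP->|/or4P[/eqP->|/eqP->|/eqP->|/orP[]/eqP->]];
  [left|left|right|right|left|right|left|right] => n pi;
  [ apply: (@occurrences_nonrlmax n pi _ _ pi perm_inj)
  | apply: (@occurrences_nonrlmax n pi _ _ id (@inj_id _))
  | apply: (@occurrences_nonlrmin n pi _ _ (@rev_ord n) rev_ord_inj)
  | apply: (@occurrences_nonlrmin n pi _ _ _ (perm_rev_inj n pi))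
  | apply: (@occurrences_nonrlmax n pi _ _ (@rev_ord n) rev_ord_inj)
  | apply: (@occurrences_nonlrmin n pi _ _ pi perm_inj)
  | apply: (@occurrences_nonrlmax n pi _ _ _ (perm_rev_inj n pi))
  | apply: (@occurrences_nonlrmin n pi _ _ id (@inj_id _))] => i j k;
  move: (perm_val n pi k i) (perm_val n pi k j) (ltn_ord i) (ltn_ord j)
    (ltn_ord k) (ltn_ord (pi i)) (ltn_ord (pi j)) (ltn_ord (pi k));
  rewrite /in_cell /gridline /=; lia.
Qed.

(** * The recurrence by insertion *)

(* c(n, n - k), as stirling1_corank shows. *)
Fixpoint corank_stirling (n k : nat) : nat :=
  if n is n'.+1 then
    (corank_stirling n' k
     + n' * (if k is k'.+1 then corank_stirling n' k' else 0))%N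
  else (k == 0)%N.

(** Of the [n.+1] insertions into each permutation, the one at [top n] keeps the statistic and the
    other [n] raise it by one. *)
Lemma card_insertion_stat (f : forall n, 'S_n -> nat)
    (ins : forall n, 'I_n.+1 -> 'S_n -> 'S_n.+1) (top : forall n, 'I_n.+1) :
  (forall pi : 'S_0, f 0%N pi = 0%N) ->
  (forall n, injective (fun js : 'I_n.+1 * 'S_n => ins n js.1 js.2)) ->
  (forall n j pi, f n.+1 (ins n j pi) = (f n pi + (j != top n))%N) ->
  forall n k, #|[set pi | f n pi == k]| = corank_stirling n k.
Proof.
move=> f0 ins_inj fS; elim=> [|n IHn] k /=.
  under eq_finset => pi do rewrite f0 eq_sym.
  by case: eqP => _; rewrite ?cardsT ?cards0 // card_Sn.
(* Injectivity suffices, both sides having [n.+1]! elements. *)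
have ins_bij : bijective (fun js : 'I_n.+1 * 'S_n => ins n js.1 js.2).
  by apply: (inj_card_bij (@ins_inj n)); rewrite card_prod !card_ord !card_Sn factS.
rewrite -(on_card_preimset (onW_bij _ ins_bij)).
(* For [k = 0] no smaller value of the statistic exists, hence the empty set. *)
pose Below := if k is k'.+1 then [set pi | f n pi == k'] else set0.
have -> : (fun js : 'I_n.+1 * 'S_n => ins n js.1 js.2) @^-1: [set pi | f n.+1 pi == k] =
    setX [set top n] [set pi | f n pi == k] :|: setX [set~ top n] Below.
  apply/setP => -[j pi]; rewrite !inE /= fS.
  case: (j == top n) => /=; first by rewrite addn0 orbF.
  by rewrite addn1 /Below; case: (k) => [|k']; rewrite inE ?eqSS.
rewrite cardsU [_ :&: _](_ : _ = set0); last first.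
  by apply/setP => -[j pi]; rewrite !inE /=; case: (j == _); rewrite ?andbF.
rewrite cards0 subn0 !cardsX cards1 mul1n IHn cardsC1 card_ord.
by rewrite /Below; case: (k) => [|k']; rewrite ?cards0 ?IHn.
Qed.

Lemma lift_perm_inj (n : nat) (h : 'I_n.+1) :
  injective (fun js : 'I_n.+1 * 'S_n => lift_perm h js.1 js.2).
Proof.
move=> [j pi] [j' pi'] /= eq_lift.
have eqj : j = j' by have := congr1 (fun u : 'S_n.+1 => u h) eq_lift; rewrite !lift_perm_id.
subst j'; congr (_, _); apply/permP => x; apply: (@lift_inj _ j).
by rewrite -!(lift_perm_lift h) eq_lift.
Qed.

Lemma ltn_lift (n : nat) (h : 'I_n.+1) (i j : 'I_n) :
  (lift h i < lift h j)%N = (i < j)%N.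
Proof. rewrite /= /bump; lia. Qed.

Lemma card_pred_lift (n : nat) (h : 'I_n.+1) (P : pred 'I_n.+1) :
  #|[set i | P i]| = (#|[set i | P (lift h i)]| + P h)%N.
Proof.
rewrite -!sum1dep_card big_mkcond (bigD1_ord h) //= -big_mkcond addnC.
by case: (P h).
Qed.

(** A new first entry lies to the right of nothing, so it leaves the status of the others unchanged;
    it is itself a right-to-left maximum only if its value is the largest. *)
Lemma num_nonrlmax_lift (n : nat) (j : 'I_n.+1) (pi : 'S_n) :
  num_nonrlmax (lift_perm ord0 j pi) = (num_nonrlmax pi + (j != ord_max))%N.
Proof.
rewrite /num_nonrlmax (card_pred_lift ord0).
congr (_ + nat_of_bool _)%N.
  apply: eq_card => i; rewrite !inE; apply/existsP/existsP => -[k].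
    case: (unliftP ord0 k) => [k'|] -> //.
    by rewrite !lift_perm_lift !ltn_lift; exists k'.
  by move=> Hk; exists (lift ord0 k); rewrite !lift_perm_lift !ltn_lift.
apply/existsP/idP => [[k]|].
  rewrite lift_perm_id => /andP[_]; apply: contraTneq => ->.
  by rewrite -leqNgt -ltnS.
(* The witness is the position of the largest value. *)
move=> j_lt; exists ((lift_perm ord0 j pi)^-1 ord_max)%g.
rewrite permKV lift_perm_id; apply/andP; split.
  rewrite lt0n; apply: contraNneq j_lt => max_at0.
  have inv_max : (lift_perm ord0 j pi)^-1%g ord_max = ord0 by exact: val_inj.
  by rewrite -(permKV (lift_perm ord0 j pi) ord_max) inv_max lift_perm_id.
by rewrite ltn_neqAle -ltnS ltn_ord andbT.
Qed.

Lemma num_nonlrmin_lift (n : nat) (j : 'I_n.+1) (pi : 'S_n) :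
  num_nonlrmin (lift_perm ord_max j pi) = (num_nonlrmin pi + (j != ord0))%N.
Proof.
rewrite /num_nonlrmin (card_pred_lift ord_max).
congr (_ + nat_of_bool _)%N.
  apply: eq_card => i; rewrite !inE; apply/existsP/existsP => -[k].
    case: (unliftP ord_max k) => [k'|] ->.
      by rewrite !lift_perm_lift !ltn_lift; exists k'.
    by rewrite [(_ < _)%N]ltnNge -ltnS ltn_ord.
  by move=> Hk; exists (lift ord_max k); rewrite !lift_perm_lift !ltn_lift.
apply/existsP/idP => [[k]|].
  by rewrite lift_perm_id => /andP[_]; apply: contraTneq => ->.
move=> j_gt; exists ((lift_perm ord_max j pi)^-1 ord0)%g.
rewrite permKV lift_perm_id lt0n j_gt andbT.
rewrite ltn_neqAle -ltnS ltn_ord andbT; apply: contraNneq j_gt => min_atmax.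
have inv_min : (lift_perm ord_max j pi)^-1%g ord0 = ord_max by exact: val_inj.
by rewrite -(permKV (lift_perm ord_max j pi) ord0) inv_min lift_perm_id.
Qed.

Lemma s_corank_stirling (R : mesh12) (n k : nat) :
  R \in eight_patterns -> s R n k = corank_stirling n k.
Proof.
move=> /eight_patternsP[] occE; rewrite /s.
  under eq_finset => pi do rewrite occE.
  apply: (card_insertion_stat _ (fun m => @lift_perm_inj m ord0)
    (@num_nonrlmax_lift)) => pi.
  by apply: eq_card0 => -[].
under eq_finset => pi do rewrite occE.
apply: (card_insertion_stat _ (fun m => @lift_perm_inj m ord_max)
  (@num_nonlrmin_lift)) => pi.
by apply: eq_card0 => -[].
Qed.

(** * Cycle counts under insertion *)

Lemma lift_permX (n : nat) (h : 'I_n.+1) (pi : 'S_n) (m : nat) :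
  (lift_perm h h pi ^+ m = lift_perm h h (pi ^+ m))%g.
Proof.
elim: m => [|m IHm]; first by rewrite !expg0 lift_perm1.
by rewrite !expgS IHm lift_permM.
Qed.

Lemma porbit_lift (n : nat) (h : 'I_n.+1) (pi : 'S_n) (i : 'I_n) :
  porbit (lift_perm h h pi) (lift h i) = lift h @: porbit pi i.
Proof.
apply/setP => x; apply/porbitP/imsetP => [[m ->]|[_ /porbitP[m ->] ->]].
  exists ((pi ^+ m)%g i); first exact: mem_porbit.
  by rewrite lift_permX lift_perm_lift.
by exists m; rewrite lift_permX lift_perm_lift.
Qed.

Lemma porbit_lift_id (n : nat) (h : 'I_n.+1) (pi : 'S_n) :
  porbit (lift_perm h h pi) h = [set h].
Proof.
apply/setP => x; rewrite inE; apply/porbitP/eqP => [[m ->]|->].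
  by rewrite lift_permX lift_perm_id.
by exists 0%N; rewrite perm1.
Qed.

Lemma card_porbits_lift (n : nat) (h : 'I_n.+1) (pi : 'S_n) :
  #|porbits (lift_perm h h pi)| = #|porbits pi|.+1.
Proof.
have -> : porbits (lift_perm h h pi) =
          [set h] |: (fun A : {set 'I_n} => lift h @: A) @: porbits pi.
  apply/setP => A; apply/imsetP/setU1P => [[x _ ->]|[->|/imsetP[_ /imsetP[i _ ->] ->]]].
  - case: (unliftP h x) => [i|] ->; last by left; rewrite porbit_lift_id.
    by right; rewrite porbit_lift; do 2!apply: imset_f.
  - by exists h; rewrite ?porbit_lift_id.
  by exists (lift h i); rewrite ?porbit_lift.
rewrite cardsU1 card_imset; last exact/imset_inj/lift_inj.
(* The singleton cycle is new, because [h] is outside the range of [lift h]. *)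
case: imsetP => // -[A _ /setP/(_ h)]; rewrite inE eqxx => /esym/imsetP[i _ eq_h].
by have := neq_lift h i; rewrite -eq_h eqxx.
Qed.

Lemma card_porbits_le (n : nat) (pi : 'S_n) : (#|porbits pi| <= n)%N.
Proof. by rewrite -[X in (_ <= X)%N]card_ord leq_imset_card. Qed.

(** Products act from left to right: [j] now maps to [ord0], and [ord0] to the former image of [j].
    For [j = ord0] the new element is a fixed point. *)
Definition insert_in_cycle (n : nat) (j : 'I_n.+1) (pi : 'S_n) : 'S_n.+1 :=
  (tperm ord0 j * lift_perm ord0 ord0 pi)%g.

(** The index [j] is recovered as the preimage of [ord0]; the transposition then cancels. *)
Lemma insert_in_cycle_inj (n : nat) :
  injective (fun js : 'I_n.+1 * 'S_n => insert_in_cycle js.1 js.2).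
Proof.
move=> [j pi] [j' pi'] /= eq_ins.
have ins_j (k : 'I_n.+1) (rho : 'S_n) : insert_in_cycle k rho k = ord0.
  by rewrite permM tpermR lift_perm_id.
have eqj : j = j'.
  by apply: (@perm_inj _ (insert_in_cycle j' pi')); rewrite ins_j -eq_ins ins_j.
subst j'; have /(@lift_perm_inj _ _ (_, _) (_, _))[->] // := mulgI _ _ _ eq_ins.
Qed.

(** For [j != ord0] the transposition merges the singleton cycle of [ord0] into that of [j], undoing
    the increase in the number of cycles. *)
Lemma corank_porbits_insert (n : nat) (j : 'I_n.+1) (pi : 'S_n) :
  (n.+1 - #|porbits (insert_in_cycle j pi)| =
   n - #|porbits pi| + (j != ord0))%N.
Proof.
have := porbits_mul_tperm (lift_perm ord0 ord0 pi) ord0 j.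
rewrite /= -/(insert_in_cycle j pi) card_porbits_lift.
rewrite porbit_sym porbit_lift_id inE (eq_sym ord0).
(* These bounds keep the natural subtractions from truncating. *)
have := card_porbits_le pi; have := card_porbits_le (insert_in_cycle j pi).
move: #|porbits (insert_in_cycle j pi)| #|porbits pi| => c p.
by case: (j == ord0) => /=; lia.
Qed.

Lemma stirling1_corank (n k : nat) :
  corank_stirling n k = if (k <= n)%N then stirling1 n (n - k) else 0%N.
Proof.
rewrite -(card_insertion_stat (f := fun m (pi : 'S_m) => (m - #|porbits pi|)%N)
  _ insert_in_cycle_inj corank_porbits_insert) //.
case: leqP => [le_kn | lt_nk].
  apply: eq_card => pi; rewrite !inE; have := card_porbits_le pi; lia.
apply: eq_card0 => pi; rewrite !inE; lia.
Qed.

(** * The exponential generating function *)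

(** Multiplication by [1 + 'X *+ n] performs the recurrence on coefficients. *)
Lemma coef_prod_corank (K : nzRingType) (n k : nat) :
  (\prod_(i < n) (1 + 'X *+ i) : {poly K})`_k = (corank_stirling n k)%:R.
Proof.
elim: n k => [|n IHn] k; first by rewrite big_ord0 coef1.
rewrite big_ord_recr /= mulrDr mulr1 mulrnAr coefD coefMn coefMX !IHn.
by case: k => [|k] /=; rewrite ?mul0rn ?muln0 ?addn0 ?addr0 // natrD mulnC natrM mulr_natr.
Qed.

Lemma egf_prod (R : mesh12) (n : nat) : R \in eight_patterns ->
  egf R n = (\prod_(i < n) (1 + q *+ i)) / n`!%:R.
Proof.
move=> R8; rewrite /egf.
have -> : egf_poly R n = (\prod_(i < n) (1 + 'X *+ i)) * (n`!%:R^-1)%:P.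
  by apply/polyP => k; rewrite coef_egf_poly coefMC coef_prod_corank s_corank_stirling.
have fact_neq0 : (n`!%:R : rat) != 0 by rewrite Num.Theory.pnatr_eq0 -lt0n fact_gt0.
rewrite rmorphM rmorph_prod; congr (_ * _).
  by apply: eq_bigr => i _; rewrite rmorphD rmorph1 rmorphMn.
rewrite -[RHS]mul1r; apply: (canRL (mulfK _)).
  rewrite -(rmorph_nat (@tofrac {poly rat})) tofrac_eq0 -polyC_natr polyC_eq0.
  exact: fact_neq0.
rewrite -(rmorph_nat (@tofrac {poly rat})) -rmorphM -polyC_natr -polyCM.
by rewrite mulVf // rmorph1.
Qed.

Lemma fps_expn_monomial (K : fieldType) (f : fps K) (a : K) (m n : nat) :
  (forall i, f i = a * (i == 1)%:R) -> fps_expn f m n = a ^+ m * (n == m)%:R.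
Proof.
move=> fE; elim: m n => [|m IHm] [|n]; rewrite /fps_expn /= ?expr0 ?mul1r //.
  by rewrite /fps_mul big_ord1 fE !mulr0 mul0r.
rewrite -/(fps_expn f m) /fps_mul !big_ord_recl big1 => [|i _]; rewrite !fE !mulr0 ?mul0r //.
by rewrite add0r addr0 mulr1 subSS subn0 IHm mulrA -exprS.
Qed.

(** The base minus one is the monomial with coefficient [- b] in degree 1, so only the term [m = n]
    contributes. *)
Lemma fps_pow_binomial (K : fieldType) (a b : K) (n : nat) :
  fps_pow (fps_sub (fps_one K) (fps_scale b (fps_X K))) a n =
  gbinomial a n * (- b) ^+ n.
Proof.
have expnE m : fps_expn (fps_sub (fps_sub (fps_one K) (fps_scale b (fps_X K)))
                           (fps_one K)) m n = (- b) ^+ m * (n == m)%:R.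
  by apply: fps_expn_monomial => i; rewrite /fps_sub /fps_scale /fps_X; ring.
rewrite /fps_pow big_ord_recr big1 /= => [|i _]; rewrite expnE.
  by rewrite add0r eqxx mulr1.
by rewrite gtn_eqF ?mulr0.
Qed.

(** Each of the [n] factors of the binomial absorbs one [- a]: (-1/a - i)(-a) = 1 + i a. *)
Lemma gbinomial_opp_inv (K : fieldType) (a : K) (n : nat) : a != 0 ->
  gbinomial (- a^-1) n * (- a) ^+ n = (\prod_(i < n) (1 + a *+ i)) / n`!%:R.
Proof.
move=> a_neq0; rewrite /gbinomial mulrAC -[X in _ ^+ X]card_ord -prodr_const.
rewrite -big_split /=; congr (_ / _); apply: eq_bigr => i _.
by rewrite mulrBl mulrNN mulVf // mulrN opprK mulr_natl.
Qed.

Theorem theorem5p1 :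
  (forall R1 R2 : mesh12,
     R1 \in eight_patterns -> R2 \in eight_patterns -> equidistributed R1 R2)
  /\
  (forall R : mesh12, R \in eight_patterns ->
     [/\ forall n k : nat, (1 <= n)%N ->
           s R n k = (s R n.-1 k
                      + n.-1 * (if k is k'.+1 then s R n.-1 k' else 0))%N,
         [/\ s R 0 0 = 1%N, s R 1 0 = 1%N & s R 1 1 = 0%N],
         forall n k : nat,
           s R n k = (if (k <= n)%N then stirling1 n (n - k) else 0%N)
       & forall n : nat,
           egf R n =
           fps_pow (fps_sub (fps_one Qq) (fps_scale q (fps_X Qq))) (- q^-1) n]).
Proof.
split=> [R1 R2 R1in R2in n k | R Rin]; first by rewrite !s_corank_stirling.
split=> [[|n] k //= _ | | n k | n].
- by rewrite !s_corank_stirling //; case: k => // k; rewrite s_corank_stirling.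
- by rewrite !s_corank_stirling.
- by rewrite s_corank_stirling // stirling1_corank.
by rewrite egf_prod // fps_pow_binomial gbinomial_opp_inv // tofrac_eq0 polyX_eq0.
Qed.
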